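(* Let $n=3$ and $\kappa=1$. For all $u,v\in\mathcal A_3^*$, $$u\equiv_{\mathrm{knu}}v\iff\big(\mho(u)=\mho(v)\ \text{and}\ \Omega(u)=\Omega(v)\big).$$ Equivalently, $w\mapsto(\mho(w),\Omega(w))$ induces an injective monoid homomorphism from the plactic monoid $\mathcal P_3=\mathcal A_3^*/{\equiv_{\mathrm{knu}}}$ into $\mathrm{TMat}_3(\mathbb T)\times\mathrm{TMat}_3(\mathbb T)$.
   Context: $\mathcal A_3=\{a_1<a_2<a_3\}$; $\equiv_{\mathrm{knu}}$ is the congruence generated by $xzy=zxy$ ($x\le y<z$) and $yxz=yzx$ ($x<y\le z$). Max-plus semiring $\mathbb T=\mathbb R\cup\{-\infty\}$, product $(X\odot Y)_{i,j}=\max_t(x_{i,t}+y_{t,j})$; $\mathrm{TMat}_3(\mathbb T)$ the upper triangular $3\times3$ matrices. $\mho,\Omega$ are the monoid homomorphisms with $\mho(e)=\Omega(e)=E$, $\mho(a_\ell)=A^{(\ell)}$, $\Omega(a_\ell)=\check A^{(\ell)}$, where $E_{i,j}=0$ ($i\le j$), $-\infty$ ($i>j$); $A^{(\ell)}_{i,j}=1$ if $i\le\ell\le j$, $0$ if $i\le j$ otherwise, $-\infty$ if $i>j$; $\check A^{(\ell)}_{4-\ell,4-\ell}=-1$, $\check A^{(\ell)}_{i,j}=0$ for all other $i\le j$, $-\infty$ for $i>j$. *)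

(* Defs.v *)
From HB Require Import structures.
From mathcomp Require Import all_boot all_order all_algebra.
From Stdlib Require Import Relations.
Set Implicit Arguments. Unset Strict Implicit. Unset Printing Implicit Defensive.
Import Order.TTheory GRing.Theory Num.Theory.
Local Open Scope ring_scope.

(* Alphabet A_3 = {a_1 < a_2 < a_3}: letter a_l is represented by (l-1 : 'I_3). *)
Definition letter := 'I_3.
Definition word := seq letter.

Inductive knu_step : word -> word -> Prop :=
| knu1 (p s : word) (x y z : letter) :
    (x <= y)%N -> (y < z)%N ->
    knu_step (p ++ [:: x; z; y] ++ s) (p ++ [:: z; x; y] ++ s)
| knu2 (p s : word) (x y z : letter) :
    (x < y)%N -> (y <= z)%N ->
    knu_step (p ++ [:: y; x; z] ++ s) (p ++ [:: y; z; x] ++ s).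

Definition knu_equiv : word -> word -> Prop := clos_refl_sym_trans word knu_step.

(* Tropical (max-plus) semiring restricted to Z ∪ {-oo}; None = -oo. *)
Definition trop := option int.
Definition tadd (a b : trop) : trop :=
  match a, b with Some x, Some y => Some (x + y)%R | _, _ => None end.
Definition tmax (a b : trop) : trop :=
  match a, b with
  | Some x, Some y => Some (Num.max x y)
  | None, _ => b
  | _, None => a
  end.

Definition tmat := 'M[trop]_3.

Definition tmul (X Y : tmat) : tmat :=
  \matrix_(i < 3, j < 3) \big[tmax/None]_(t < 3) tadd (X i t) (Y t j).

Definition tE : tmat :=
  \matrix_(i < 3, j < 3) if (i <= j)%N then Some 0%R else None.

Definition tA (l : letter) : tmat :=
  \matrix_(i < 3, j < 3)
    if (i <= j)%N then (if (i <= l <= j)%N then Some 1%R else Some 0%R) else None.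

(* check A^(l): entry (4-l,4-l) (1-based) is -1, i.e. 0-based index 2 - l *)
Definition tAc (l : letter) : tmat :=
  \matrix_(i < 3, j < 3)
    if (i <= j)%N then
      (if (i == j) && (nat_of_ord i == 2 - l)%N then Some (-1)%R else Some 0%R)
    else None.

Definition mho (w : word) : tmat := foldr (fun a M => tmul (tA a) M) tE w.
Definition Omega (w : word) : tmat := foldr (fun a M => tmul (tAc a) M) tE w.

(* Main.v *)
(** Knuth invariance of both maps reduces, by associativity of the tropical
    product, to finitely many identities between products of three generators.
    Conversely, row insertion turns every word into the row reading
    3^a 2^b 3^c 1^d 2^e 3^f of a semistandard tableau, and the six multiplicities
    can be read off the matrices: entries (1,2), (2,2), (1,3), (3,3) of mho are
    d + e, b + e, d + e + f, a + c + f, while entries (1,3) and (3,3) of Omega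
    are - a and - d.  Entry (1,3) of Omega is what recovers the third row, which
    lengths of nondecreasing subwords alone do not detect. *)

From Stdlib Require Import Relations.
Require Import Defs.
From mathcomp Require Import all_boot all_order all_algebra.
From mathcomp Require Import zify.
Set Implicit Arguments. Unset Strict Implicit. Unset Printing Implicit Defensive.
Import Order.TTheory GRing.Theory Num.Theory.
Local Open Scope ring_scope.

Notation a1 := (@Ordinal 3 0 isT).
Notation a2 := (@Ordinal 3 1 isT).
Notation a3 := (@Ordinal 3 2 isT).

(** The cases are literal ordinals with proof [isT], so that comparisons of letters and indices
    reduce by computation. *)
Lemma I3P (P : 'I_3 -> Prop) : P a1 -> P a2 -> P a3 -> forall i, P i.
Proof.
move=> P1 P2 P3 [[|[|[|//]]] Hi]; by rewrite (bool_irrelevance Hi isT).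
Qed.

(** * Tropical matrices *)

Lemma tmaxA : associative tmax.
Proof. by move=> [x|] [y|] [z|] //=; rewrite maxA. Qed.

Lemma tmaxC : commutative tmax.
Proof. by move=> [x|] [y|] //=; rewrite maxC. Qed.

Lemma taddA : associative tadd.
Proof. by move=> [x|] [y|] [z|] //=; rewrite addrA. Qed.

Lemma tadd_maxl x y z : tadd (tmax x y) z = tmax (tadd x z) (tadd y z).
Proof. by case: x y z => [x|] [y|] [z|] //=; rewrite addr_maxl. Qed.

Lemma tadd_maxr x y z : tadd x (tmax y z) = tmax (tadd x y) (tadd x z).
Proof. by case: x y z => [x|] [y|] [z|] //=; rewrite addr_maxr. Qed.

Lemma tmulE (X Y : tmat) i j :
  tmul X Y i j =
  tmax (tadd (X i a1) (Y a1 j)) (tmax (tadd (X i a2) (Y a2 j)) (tadd (X i a3) (Y a3 j))).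
Proof.
rewrite mxE !big_ord_recl big_ord0.
rewrite (_ : ord0 = a1); last exact: val_inj.
rewrite (_ : lift _ _ = a2); last exact: val_inj.
rewrite (_ : lift _ _ = a3); last exact: val_inj.
by congr tmax; congr tmax; case: tadd.
Qed.

Lemma tmulA : associative tmul.
Proof.
have tmaxACA a b c d : tmax (tmax a b) (tmax c d) = tmax (tmax a c) (tmax b d).
  by rewrite -!tmaxA (tmaxA b) (tmaxC b) -!tmaxA.
(* Both bracketings are maxima of the same nine triple sums, grouped by rows on one side and by
   columns on the other. *)
have tmax33 a b c d e f g h k :
    tmax (tmax a (tmax b c)) (tmax (tmax d (tmax e f)) (tmax g (tmax h k))) =
    tmax (tmax a (tmax d g)) (tmax (tmax b (tmax e h)) (tmax c (tmax f k))).
  by rewrite (tmaxACA d) (tmaxACA e) (tmaxACA a) (tmaxACA b).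
move=> X Y Z; apply/matrixP => i j; rewrite !(tmulE _ _ i j) !tmulE.
rewrite !tadd_maxl !tadd_maxr !taddA.
exact: tmax33.
Qed.

(** * Knuth invariance of tropical products *)

Definition knuth_rep (F : letter -> tmat) : Prop :=
  (forall x y z : letter, (x <= y)%N -> (y < z)%N ->
     tmul (F x) (tmul (F z) (F y)) = tmul (F z) (tmul (F x) (F y))) /\
  (forall x y z : letter, (x < y)%N -> (y <= z)%N ->
     tmul (F y) (tmul (F x) (F z)) = tmul (F y) (tmul (F z) (F x))).

(** The common prefix is folded identically, and associativity splits the suffix off from the three
    exchanged letters. *)
Lemma knuth_rep_equiv F u v : knuth_rep F -> knu_equiv u v ->
  foldr (fun a M => tmul (F a) M) tE u = foldr (fun a M => tmul (F a) M) tE v.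
Proof.
move=> [F1 F2]; elim=> {u v} [u v uv|//|u v _ -> //|u v w _ -> _ -> //].
case: uv => p s x y z xy yz; rewrite !foldr_cat /=; congr foldr.
- by have := F1 _ _ _ xy yz; rewrite !tmulA => ->.
- by have := F2 _ _ _ xy yz; rewrite !tmulA => ->.
Qed.

Lemma knuth_rep_tA : knuth_rep tA.
Proof.
split; do 3 elim/I3P; move=> // _ _; apply/matrixP;
  do 2 elim/I3P; by rewrite !tmulE !mxE; vm_compute.
Qed.

Lemma knuth_rep_tAc : knuth_rep tAc.
Proof.
split; do 3 elim/I3P; move=> // _ _; apply/matrixP;
  do 2 elim/I3P; by rewrite !tmulE !mxE; vm_compute.
Qed.

(** * Row insertion *)

Infix "~=" := knu_equiv (at level 70).

Lemma knu_refl u : u ~= u. Proof. exact: rst_refl. Qed.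

Lemma knu_sym u v : u ~= v -> v ~= u. Proof. exact: rst_sym. Qed.

Lemma knu_trans v u w : u ~= v -> v ~= w -> u ~= w.
Proof. exact: rst_trans. Qed.

Lemma knu_ctx p s u v : u ~= v -> p ++ u ++ s ~= p ++ v ++ s.
Proof.
elim=> {u v} [u v uv|u|u v _|u v w _ uv _ vw].
- apply: rst_step; case: uv => p' s' x y z xy yz.
  + by have := @knu1 (p ++ p') (s' ++ s) x y z xy yz; rewrite -!catA.
  + by have := @knu2 (p ++ p') (s' ++ s) x y z xy yz; rewrite -!catA.
- exact: knu_refl.
- exact: knu_sym.
- exact: knu_trans uv vw.
Qed.

Lemma knu_catl p u v : u ~= v -> p ++ u ~= p ++ v.
Proof. by move=> /(knu_ctx p [::]); rewrite !cats0. Qed.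

Lemma knu_catr s u v : u ~= v -> u ++ s ~= v ++ s.
Proof. exact: (knu_ctx [::]). Qed.

Definition leql : rel letter := fun x y => (x <= y)%N.

(** The inserted [x] passes the letters of [s] from right to left by [knu2], the letter before each
    pair acting as the witness. *)
Lemma move_left (x y : letter) s :
  (x < y)%N -> path leql y s -> y :: rcons s x ~= y :: x :: s.
Proof.
elim: s y => [|z s IH] y xy /=; first by move=> _; exact: knu_refl.
case/andP=> yz zs; apply: (@knu_trans (y :: z :: x :: s)).
  exact: (knu_catl [:: y] (IH z (leq_trans xy yz) zs)).
by apply/knu_sym/rst_step/(@knu2 [::] s x y z).
Qed.

(** The bumped [y] passes the letters of [p] by [knu1]; the witness is the next letter of the row,
    which is at most [x] and so below [y]. *)
Lemma bump_left (x y : letter) p :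
  (x < y)%N -> sorted leql (rcons p x) -> p ++ [:: y; x] ~= y :: rcons p x.
Proof.
move=> xy; elim: p => [|q p IH] /=; first by move=> _; exact: knu_refl.
move=> srt; apply: (@knu_trans (q :: y :: rcons p x)).
  exact: (knu_catl [:: q] (IH (path_sorted srt))).
case: p srt {IH} => [|t p] /=.
  by case/andP=> qx _; apply/rst_step/(@knu1 [::] [::] q x y).
case/andP=> qt tp; apply/rst_step/(@knu1 [::] (rcons p x) q t y) => //.
have leql_trans : transitive leql by move=> ? ? ?; exact: leq_trans.
have /allP/(_ x) := order_path_min leql_trans tp.
by rewrite mem_rcons inE eqxx => /(_ isT) tx; apply: leq_ltn_trans xy.
Qed.

(** One Schensted bump: [y] is the leftmost letter exceeding [x]; [x] takes its place and [y] leaves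
    towards the row below. *)
Lemma row_insert (x y : letter) p s :
  (x < y)%N -> sorted leql (rcons p x) -> path leql y s ->
  p ++ y :: rcons s x ~= y :: p ++ x :: s.
Proof.
move=> xy px ys; apply: (@knu_trans (p ++ y :: x :: s)).
  exact/knu_catl/move_left.
by have := knu_catr s (bump_left xy px); rewrite -!catA /= cat_rcons.
Qed.

Definition row (d e f : nat) : word := nseq d a1 ++ nseq e a2 ++ nseq f a3.

Lemma nseq_rcons (T : Type) n (x : T) : rcons (nseq n x) x = nseq n.+1 x.
Proof. by elim: n => //= n ->. Qed.

Lemma nseq_cat_cons (T : Type) n (x : T) s : nseq n x ++ x :: s = nseq n.+1 x ++ s.
Proof. by rewrite -nseq_rcons cat_rcons. Qed.

Lemma path_nseq (x y : letter) n s :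
  (x <= y)%N -> path leql y s -> path leql x (nseq n y ++ s).
Proof.
move=> xy ys; elim: n x xy => [|n IH] x xy /=; last by rewrite /leql xy IH.
by case: s ys => //= z s /andP[yz ->]; rewrite /leql (leq_trans xy yz).
Qed.

Lemma sorted_row d e f : sorted leql (row d e f).
Proof.
apply: (@path_sorted _ _ a1); apply: path_nseq => //; apply: path_nseq => //.
by rewrite -(cats0 (nseq f a3)); apply: path_nseq.
Qed.

Lemma row_rcons3 d e f : rcons (row d e f) a3 = row d e f.+1.
Proof. by rewrite /row !rcons_cat nseq_rcons. Qed.

Lemma row_rcons2 d e : rcons (row d e 0) a2 = row d e.+1 0.
Proof. by rewrite /row /= !cats0 rcons_cat nseq_rcons. Qed.

Lemma row_rcons1 d : rcons (row d 0 0) a1 = row d.+1 0 0.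
Proof. by rewrite /row /= !cats0 nseq_rcons. Qed.

(** Here and in the next two lemmas the bumped letter is the smallest larger one present: [1] bumps
    a [2] if there is one, otherwise a [3]. *)
Lemma row_bump32 d e f : rcons (row d e f.+1) a2 ~= a3 :: row d e.+1 f.
Proof.
have := @row_insert a2 a3 (row d e 0) (nseq f a3) isT.
rewrite row_rcons2 sorted_row -(cats0 (nseq f a3)) path_nseq // => /(_ isT isT).
by rewrite /row !cats0 !rcons_cat -!catA nseq_cat_cons.
Qed.

Lemma row_bump21 d e f : rcons (row d e.+1 f) a1 ~= a2 :: row d.+1 e f.
Proof.
have := @row_insert a1 a2 (row d 0 0) (nseq e a2 ++ nseq f a3) isT.
rewrite row_rcons1 sorted_row -(cats0 (nseq f a3)) !path_nseq // => /(_ isT isT).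
by rewrite /row /= !cats0 nseq_cat_cons !rcons_cat /= ?rcons_cat.
Qed.

Lemma row_bump31 d f : rcons (row d 0 f.+1) a1 ~= a3 :: row d.+1 0 f.
Proof.
have := @row_insert a1 a3 (row d 0 0) (nseq f a3) isT.
rewrite row_rcons1 sorted_row -(cats0 (nseq f a3)) path_nseq // => /(_ isT isT).
by rewrite /row /= !cats0 nseq_cat_cons !rcons_cat /= ?rcons_cat.
Qed.

(** * Tableaux *)

(* The tableau has rows 1^d 2^e 3^f, 2^b 3^c and 3^a; is_tab says that its columns increase. *)
Definition is_tab (a b c d e : nat) : bool := [&& a <= b, b <= d & b + c <= d + e]%N.

(** Rows are read from bottom to top; writing all three with [row] lets the same row lemmas serve
    each of them. *)
Definition tab (a b c d e f : nat) : word := row 0 0 a ++ row 0 b c ++ row d e f.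

(** The letter enters the first row, and whatever it bumps is inserted into the row below. *)
Lemma rcons_tab x a b c d e f : is_tab a b c d e ->
  exists a' b' c' d' e' f',
    is_tab a' b' c' d' e' /\ rcons (tab a b c d e f) x ~= tab a' b' c' d' e' f'.
Proof.
rewrite /is_tab /tab => T.
have appE : rcons (row 0 0 a ++ row 0 b c ++ row d e f) x =
    row 0 0 a ++ row 0 b c ++ rcons (row d e f) x.
  by rewrite rcons_cat (rcons_cat x (row 0 b c)).
(* Covers a letter [y] bumped from the first row that is put at the end of the second. *)
have bump1 y r r' : rcons (row d e f) x ~= y :: r -> rcons (row 0 b c) y = r' ->
    rcons (row 0 0 a ++ row 0 b c ++ row d e f) x ~= row 0 0 a ++ r' ++ r.
  move=> h <-; rewrite appE; apply: (knu_catl (row 0 0 a)).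
  by rewrite cat_rcons; apply: (knu_catl (row 0 b c)).
elim/I3P: x appE bump1 => appE bump1.
- case: e T appE bump1 => [|e] T appE bump1.
    case: f appE bump1 => [|f] appE bump1.
      exists a, b, c, d.+1, 0, 0; split; first lia.
      by rewrite appE row_rcons1; apply: knu_refl.
    exists a, b, c.+1, d.+1, 0, f; split; first lia.
    by apply: bump1 (row_bump31 d f) (row_rcons3 _ _ _).
  case: c T appE bump1 => [|c] T appE bump1.
    exists a, b.+1, 0, d.+1, e, f; split; first lia.
    by apply: bump1 (row_bump21 d e f) (row_rcons2 _ _).
  (* Double bump: the [1] expels a [2] from the first row, which expels a [3] from the second row
     into the third. *)
  exists a.+1, b.+1, c, d.+1, e, f; split; first lia.
  apply: knu_trans (bump1 _ _ _ (row_bump21 d e f) erefl) _.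
  rewrite -(row_rcons3 0 0 a) (cat_rcons a3 (row 0 0 a)); apply: (knu_catl (row 0 0 a)).
  exact: knu_catr (row_bump32 0 b c).
- case: f appE bump1 => [|f] appE bump1.
    exists a, b, c, d, e.+1, 0; split; first lia.
    by rewrite appE row_rcons2; apply: knu_refl.
  exists a, b, c.+1, d, e.+1, f; split; first lia.
  by apply: bump1 (row_bump32 d e f) (row_rcons3 _ _ _).
- exists a, b, c, d, e, f.+1; split; first lia.
  by rewrite appE row_rcons3; apply: knu_refl.
Qed.

Lemma knu_tab w : exists a b c d e f, is_tab a b c d e /\ w ~= tab a b c d e f.
Proof.
elim/last_ind: w => [|w x [a [b [c [d [e [f [T wT]]]]]]]].
  by exists 0, 0, 0, 0, 0, 0; split=> //; apply: knu_refl.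
have [a' [b' [c' [d' [e' [f' [T' xT]]]]]]] := rcons_tab x f T.
exists a', b', c', d', e', f'; split=> //; apply: knu_trans xT.
by rewrite -!cats1; apply: knu_catr.
Qed.

(** * Matrix entries of tableaux *)

(* The inequalities make all but the extreme terms of the max-plus products below redundant. *)
Definition col2 (M : tmat) (p q : int) : Prop :=
  [/\ M a1 a2 = Some p, M a2 a2 = Some q, M a3 a2 = None & q <= p].

Definition col3 (M : tmat) (p q r : int) : Prop :=
  [/\ M a1 a3 = Some p, M a2 a3 = Some q, M a3 a3 = Some r & r <= q <= p].

Ltac col_entries :=
  let h1 := fresh "h1" in let h2 := fresh "h2" in let h3 := fresh "h3" in
  intros h1 h2 h3 ?; split; rewrite //= ?tmulE ?mxE /= ?(h1, h2, h3) //=;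
  try congr Some; lia.

(** Entry (i,j) of [mho] is the greatest length of a nondecreasing subword with letters from i to j.
    With letters [1], [2] it takes the [d] ones, then either continues in [w] at once or takes the
    [e] twos and only twos of [w]. *)
Lemma mho_row_col2 d e f w p q : col2 (mho w) p q ->
  col2 (mho (row d e f ++ w)) (d%:Z + Num.max p (e%:Z + q)) (e%:Z + q).
Proof.
move=> Mw; rewrite /row -!catA.
have M3 : col2 (mho (nseq f a3 ++ w)) p q.
  elim: f => [//|f]; case; col_entries.
have M2 : col2 (mho (nseq e a2 ++ nseq f a3 ++ w)) (Num.max p (e%:Z + q)) (e%:Z + q).
  elim: e => [|e].
    by case: M3; col_entries.
  by case; col_entries.
elim: d => [|d].
  by case: M2; col_entries.
by case; col_entries.
Qed.

Lemma mho_row_col3 d e f w p q r : col3 (mho w) p q r ->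
  col3 (mho (row d e f ++ w))
    (d%:Z + Num.max p (e%:Z + Num.max q (r + f%:Z)))
    (e%:Z + Num.max q (r + f%:Z)) (r + f%:Z).
Proof.
move=> Mw; rewrite /row -!catA.
have M3 : col3 (mho (nseq f a3 ++ w))
    (Num.max p (r + f%:Z)) (Num.max q (r + f%:Z)) (r + f%:Z).
  elim: f => [|f].
    by case: Mw; col_entries.
  case: Mw => _ _ _ ?.
  by case; col_entries.
have M2 : col3 (mho (nseq e a2 ++ nseq f a3 ++ w))
    (Num.max p (e%:Z + Num.max q (r + f%:Z)))
    (e%:Z + Num.max q (r + f%:Z)) (r + f%:Z).
  elim: e => [|e].
    by case: M3; col_entries.
  by case; col_entries.
elim: d => [|d].
  by case: M2; col_entries.
by case; col_entries.
Qed.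

(** Letters [3], [2], [1] charge only staying at index 1, 2, 3 respectively, and moving to a larger
    index is free; hence each block offers the choice between paying and moving on. *)
Lemma Omega_row_col3 d e f w p q r : col3 (Omega w) p q r ->
  col3 (Omega (row d e f ++ w))
    (Num.max (p - f%:Z) q) (Num.max (q - e%:Z) r) (r - d%:Z).
Proof.
move=> Mw; rewrite /row -!catA.
have M3 : col3 (Omega (nseq f a3 ++ w)) (Num.max (p - f%:Z) q) q r.
  elim: f => [|f].
    by case: Mw; col_entries.
  by case; col_entries.
have M2 : col3 (Omega (nseq e a2 ++ nseq f a3 ++ w))
    (Num.max (p - f%:Z) q) (Num.max (q - e%:Z) r) r.
  elim: e => [|e].
    by case: M3; col_entries.
  case: M3 => _ _ _ ?.
  by case; col_entries.
elim: d => [|d].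
  by case: M2; col_entries.
by case; col_entries.
Qed.

Lemma mho_tab a b c d e f : is_tab a b c d e ->
  let M := mho (tab a b c d e f) in
  [/\ M a1 a2 = Some (d + e)%N%:Z, M a2 a2 = Some (b + e)%N%:Z,
      M a1 a3 = Some (d + e + f)%N%:Z & M a3 a3 = Some (a + c + f)%N%:Z].
Proof.
move=> /and3P[ab bd bcde] M.
have E2 : col2 (mho [::]) 0 0 by split; rewrite ?mxE.
have E3 : col3 (mho [::]) 0 0 0 by split; rewrite ?mxE.
have := mho_row_col2 0 0 a (mho_row_col2 0 b c (mho_row_col2 d e f E2)).
have := mho_row_col3 0 0 a (mho_row_col3 0 b c (mho_row_col3 d e f E3)).
rewrite cats0 -/(tab _ _ _ _ _ _) -/M => -[-> _ -> _] [-> -> _ _].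
(* By [b <= d] and [a + c <= b + c <= d + e], the terms [d + e] and [d + e + f] of the first row
   dominate the maxima. *)
by split; congr Some; lia.
Qed.

Lemma Omega_tab a b c d e f : is_tab a b c d e ->
  let M := Omega (tab a b c d e f) in
  M a1 a3 = Some (- a%:Z) /\ M a3 a3 = Some (- d%:Z).
Proof.
move=> /and3P[ab bd bcde] M.
have E3 : col3 (Omega [::]) 0 0 0 by split; rewrite ?mxE.
have := Omega_row_col3 0 0 a (Omega_row_col3 0 b c (Omega_row_col3 d e f E3)).
rewrite cats0 -/(tab _ _ _ _ _ _) -/M => -[-> _ -> _].
(* After the second row the column is [0], [-b], [-d] because [b <= d]; the third row turns its top
   into [max (-a) (-b)], which is [-a] because [a <= b]. *)
by split; congr Some; lia.
Qed.

(** * Separation of Knuth classes by the two matrices *)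

Theorem mainTheorem15 (u v : word) :
  knu_equiv u v <-> (mho u = mho v /\ Omega u = Omega v).
Proof.
have mho_knu x y : x ~= y -> mho x = mho y := knuth_rep_equiv knuth_rep_tA.
have Omega_knu x y : x ~= y -> Omega x = Omega y := knuth_rep_equiv knuth_rep_tAc.
split=> [uv|[]]; first by split; [apply: mho_knu | apply: Omega_knu].
have [a [b [c [d [e [f [T ut]]]]]]] := knu_tab u.
have [a' [b' [c' [d' [e' [f' [T' vt]]]]]]] := knu_tab v.
rewrite (mho_knu _ _ ut) (mho_knu _ _ vt) (Omega_knu _ _ ut) (Omega_knu _ _ vt).
move=> Emho EOmega; apply: (knu_trans ut); apply: knu_sym; apply: (knu_trans vt).
have [] := mho_tab f T; rewrite Emho; have [-> -> -> ->] := mho_tab f' T'.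
have [] := Omega_tab f T; rewrite EOmega; have [-> ->] := Omega_tab f' T'.
move=> [Ea] [Ed] [Ede] [Ebe] [Edef] [Eacf].
(* The linear system is triangular in the order [a], [d], [e], [b], [f], [c]. *)
have [-> -> -> ->] : [/\ a' = a, b' = b, c' = c & d' = d] by split; lia.
have [-> ->] : e' = e /\ f' = f by split; lia.
exact: knu_refl.
Qed.
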